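(* For every partial symmetric Boolean function $f:\{0,1\}^N\to\{0,1,\ast\}$, we have $\operatorname{R}(f)=O(\operatorname{Q}(f)^2)$, with an absolute implied constant.
   Context: A partial Boolean function $f:\{0,1\}^N\to\{0,1,\ast\}$ is defined on $S=\{X:f(X)\ne\ast\}$; it is symmetric if $f(X)$ depends only on the Hamming weight $|X|=x_1+\dots+x_N$. $\operatorname{R}(f)$ is the bounded-error randomized query complexity (expected number of queries of an optimal randomized algorithm that outputs $f(X)$ with probability $\ge2/3$ for every $X\in S$), and $\operatorname{Q}(f)$ is the bounded-error quantum query complexity (minimum number of queries of a quantum algorithm outputting $f(X)$ with probability $\ge2/3$ for every $X\in S$). *)

(* Defs.v *)
From HB Require Import structures.
From mathcomp Require Import all_boot all_order all_algebra.
From mathcomp Require Import all_classical all_reals.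
From mathcomp Require Import complex.
Set Implicit Arguments. Unset Strict Implicit. Unset Printing Implicit Defensive.
Import Order.TTheory GRing.Theory Num.Theory.
Local Open Scope ring_scope.

Definition input (N : nat) := {ffun 'I_N -> bool}.

Definition pfun (N : nat) := input N -> option bool.

Definition hweight (N : nat) (X : input N) : nat := #|[pred i | X i]|.

Definition symmetric_pfun (N : nat) (f : pfun N) : Prop :=
  forall X Y : input N, hweight X = hweight Y -> f X = f Y.

Inductive dtree (N : nat) : Type :=
| DLeaf of bool
| DNode of 'I_N & dtree N & dtree N.  (* DNode i t0 t1 : query x_i, go to t_{x_i} *)

Fixpoint dt_eval (N : nat) (X : input N) (t : dtree N) : bool :=
  match t with
  | DLeaf b => b
  | DNode i t0 t1 => if X i then dt_eval X t1 else dt_eval X t0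
  end.

Fixpoint dt_queries (N : nat) (X : input N) (t : dtree N) : nat :=
  match t with
  | DLeaf _ => 0
  | DNode i t0 t1 => (if X i then dt_queries X t1 else dt_queries X t0).+1
  end.

Section Randomized.
Variable R : realType.

(* A randomized query algorithm: a (finitely supported) probability
   distribution over deterministic decision trees. *)
Definition ralg (N : nat) := seq (R * dtree N).

Definition ralg_valid (N : nat) (A : ralg N) : Prop :=
  all (fun p : R * dtree N => 0 <= p.1) A /\ \sum_(p <- A) p.1 = 1.

Definition ralg_prob (N : nat) (A : ralg N) (X : input N) (b : bool) : R :=
  \sum_(p <- A | dt_eval X p.2 == b) p.1.

Definition ralg_exp_queries (N : nat) (A : ralg N) (X : input N) : R :=
  \sum_(p <- A) p.1 * (dt_queries X p.2)%:R.

Definition ralg_computes (N : nat) (f : pfun N) (A : ralg N) : Prop :=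
  ralg_valid A /\
  forall (X : input N) (b : bool), f X = Some b -> 2 / 3 <= ralg_prob A X b.

Definition ralg_cost (N : nat) (f : pfun N) (A : ralg N) : R :=
  \big[Num.max/0]_(X : input N | f X != None) ralg_exp_queries A X.

Definition Rquery (N : nat) (f : pfun N) : R :=
  inf [set c : R | exists A : ralg N, ralg_computes f A /\ c = ralg_cost f A].

End Randomized.

Section Quantum.
Variable R : realType.
Local Notation C := R[i].

(* Computational basis |i, w> : i in {0 (no query), 1..N}, w a workspace
   basis state among d.+1 ones. *)
Definition qbasis (N d : nat) : finType := (option 'I_N * 'I_d.+1)%type.

Definition qop (N d : nat) := qbasis N d -> qbasis N d -> C.
Definition qvec (N d : nat) := qbasis N d -> C.

Definition unitary (N d : nat) (U : qop N d) : Prop :=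
  forall j k : qbasis N d,
    \sum_(i : qbasis N d) (U i j)^* * U i k = (j == k)%:R.

Definition qapply (N d : nat) (U : qop N d) (v : qvec N d) : qvec N d :=
  fun i => \sum_(j : qbasis N d) U i j * v j.

Definition oracle (N d : nat) (X : input N) (v : qvec N d) : qvec N d :=
  fun b => (if b.1 is Some i then (if X i then -1 else 1) else 1) * v b.

Definition qinit (N d : nat) : qvec N d :=
  fun b => (b == (None, ord0))%:R.

Fixpoint qstate (N d : nat) (Us : nat -> qop N d) (X : input N) (k : nat)
  : qvec N d :=
  match k with
  | 0 => qapply (Us 0) (@qinit N d)
  | k'.+1 => qapply (Us k) (oracle X (qstate Us X k'))
  end.

Definition qprob (N d : nat) (Us : nat -> qop N d) (out : qbasis N d -> bool)
  (T : nat) (X : input N) (b : bool) : R :=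
  \sum_(beta : qbasis N d | out beta == b)
     (complex.Re (qstate Us X T beta) ^+ 2 + complex.Im (qstate Us X T beta) ^+ 2).

Definition quantum_computes (N : nat) (f : pfun N) (T : nat) : Prop :=
  exists (d : nat) (Us : nat -> qop N d) (out : qbasis N d -> bool),
    (forall k, (k <= T)%N -> unitary (Us k)) /\
    forall (X : input N) (b : bool), f X = Some b -> 2 / 3 <= qprob Us out T X b.

End Quantum.

(* Main.v *)
Require Import Defs.
From HB Require Import structures.
From mathcomp Require Import all_boot all_order all_algebra.
From mathcomp Require Import all_classical all_reals.
From mathcomp Require Import complex.
From mathcomp Require Import perm ring lra zify.
Set Implicit Arguments.
Unset Strict Implicit.
Unset Printing Implicit Defensive.
Import Order.TTheory GRing.Theory Num.Theory.
Local Open Scope ring_scope.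

(* Lower bound on quantum queries (adversary method): let weights a < b have
   opposite values, and sum Re<psi_X|psi_Y> over all pairs X <= Y of inputs of
   weights a and b. A correct algorithm must bring the average overlap from 1 down
   to 17/18. For a fixed X, a given zero of X is flipped by a fraction
   (b-a)/(N-a) of the Y's, and for a fixed Y, a given one of Y is flipped by a
   fraction (b-a)/b of the X's; so one query lowers the average overlap by
   O((b-a) / sqrt(b(N-a))), whence b(N-a) = O(T^2 (b-a)^2).

   Randomized algorithm: sample O(T^2) coordinates with replacement and output
   the value of f at the weight nearest to the estimate. The variance of the
   estimate at weight m is proportional to m(N-m), which the lower bound compares
   with the squared distance from m to the nearest opposite weight, so Chebyshev's
   inequality bounds the error. *)

(** * Overlaps of quantum states *)

Section Inner.
Variables (R : realType) (N d : nat).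
Implicit Types (u v : qvec R N d) (X Y : input N) (s : R).

Definition ip u v : R[i] := \sum_beta (u beta)^* * v beta.
(** Real parts suffice: they form the dot product of real vectors, so overlaps can be estimated one
    basis state at a time. *)
Definition reip u v : R := complex.Re (ip u v).
Definition sqn (z : R[i]) : R := complex.Re z ^+ 2 + complex.Im z ^+ 2.

Lemma ReD (x y : R[i]) : complex.Re (x + y) = complex.Re x + complex.Re y.
Proof. by case: x y => [a b] [c e]. Qed.

Lemma Re_sum (I : Type) (r : seq I) (P : pred I) (F : I -> R[i]) :
  complex.Re (\sum_(i <- r | P i) F i) = \sum_(i <- r | P i) complex.Re (F i).
Proof. by apply: (big_morph _ ReD). Qed.

Lemma Re_conjM (x y : R[i]) :
  complex.Re (x^* * y) =
  complex.Re x * complex.Re y + complex.Im x * complex.Im y.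
Proof. by case: x y => [a b] [c e] /=; ring. Qed.

Lemma reipE u v :
  reip u v = \sum_beta (complex.Re (u beta) * complex.Re (v beta)
                        + complex.Im (u beta) * complex.Im (v beta)).
Proof. by rewrite /reip /ip Re_sum; apply: eq_bigr => i _; exact: Re_conjM. Qed.

Lemma reip_self u : reip u u = \sum_beta sqn (u beta).
Proof. by rewrite reipE; apply: eq_bigr => i _; rewrite /sqn !expr2. Qed.

Lemma sqn_ge0 (z : R[i]) : 0 <= sqn z.
Proof. by rewrite addr_ge0 // sqr_ge0. Qed.

Lemma ip_unitary (U : qop R N d) u v :
  unitary U -> ip (qapply U u) (qapply U v) = ip u v.
Proof.
move=> hU; rewrite /ip /qapply.
(* Regrouping isolates the entries of [U^* U], which is the identity. *)
transitivity (\sum_j \sum_k (u j)^* * v k * \sum_i (U i j)^* * U i k).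
  under eq_bigr => i _.
    rewrite rmorph_sum mulr_suml.
    under eq_bigr => j _ do rewrite mulr_sumr.
    over.
  rewrite exchange_big; apply: eq_bigr => j _.
  rewrite exchange_big; apply: eq_bigr => k _.
  rewrite mulr_sumr; apply: eq_bigr => i _.
  by rewrite rmorphM; ring.
apply: eq_bigr => j _.
rewrite (bigD1 j) //= hU eqxx mulr1 big1 ?addr0 // => k kj.
by rewrite hU eq_sym (negbTE kj) mulr0.
Qed.

Lemma reip_unitary (U : qop R N d) u v :
  unitary U -> reip (qapply U u) (qapply U v) = reip u v.
Proof. by move=> hU; rewrite /reip ip_unitary. Qed.

Definition distinguishes X Y (beta : qbasis N d) : bool :=
  if beta.1 is Some i then X i != Y i else false.

(* The oracle calls for [X] and [Y] differ only on the basis states that query a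
   coordinate where [X] and [Y] differ; there AM-GM with weight [s] applies. *)
Lemma reip_oracle X Y s u v : 0 < s ->
  reip u v - \sum_(beta | distinguishes X Y beta)
               (s * sqn (u beta) + s^-1 * sqn (v beta))
  <= reip (oracle X u) (oracle Y v).
Proof.
move=> s0; rewrite !reipE lerBlDr [X in _ <= _ + X]big_mkcond -big_split /=.
apply: ler_sum => -[o w] _; rewrite /oracle /distinguishes /=.
case: o => [i|]; last first.
  by rewrite !mul1r addr0.
have amgm : forall a b : R, - (s * a ^+ 2 + s^-1 * b ^+ 2) <= 2 * (a * b).
  move=> a b; rewrite -subr_ge0.
  have -> : 2 * (a * b) - - (s * a ^+ 2 + s^-1 * b ^+ 2) = s * (a + s^-1 * b) ^+ 2.
    by field; rewrite gt_eqF.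
  by rewrite mulr_ge0 ?sqr_ge0 // ltW.
have amgm' : forall a b : R, 2 * (a * b) <= s * a ^+ 2 + s^-1 * b ^+ 2.
  move=> a b; have := amgm (- a) b; rewrite sqrrN mulNr; lra.
rewrite /sqn; case: (u _) (v _) => [a b] [a' b'] /=.
have := amgm' a a'; have := amgm' b b'.
case: (X i); case: (Y i) => /=; lra.
Qed.

Lemma reip_oracle_self X u : reip (oracle X u) (oracle X u) = reip u u.
Proof.
rewrite !reipE; apply: eq_bigr => -[o w] _; rewrite /oracle /=.
case: (u _) => a b; case: o => [i|] /=; last by ring.
by case: (X i) => /=; ring.
Qed.

Variables (Us : nat -> qop R N d) (T : nat).
Hypothesis hU : forall k, (k <= T)%N -> unitary (Us k).

Lemma qstate_init X Y :
  reip (qstate Us X 0) (qstate Us Y 0) = 1.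
Proof.
rewrite /= (reip_unitary _ _ (hU (leq0n T))) reipE.
rewrite (bigD1 (None, ord0)) //= big1 ?addr0 => [|beta hb]; rewrite /qinit.
  by ring.
by rewrite (negbTE hb) /=; ring.
Qed.

Lemma qstate_norm X k : (k <= T)%N ->
  \sum_beta sqn (qstate Us X k beta) = 1.
Proof.
rewrite -reip_self; elim: k => [|k IHk] hk; first exact: qstate_init.
by rewrite /= (reip_unitary _ _ (hU hk)) reip_oracle_self IHk // ltnW.
Qed.

Lemma qstate_step X Y s k : 0 < s -> (k < T)%N ->
  reip (qstate Us X k) (qstate Us Y k)
    - \sum_(beta | distinguishes X Y beta)
        (s * sqn (qstate Us X k beta) + s^-1 * sqn (qstate Us Y k beta))
  <= reip (qstate Us X k.+1) (qstate Us Y k.+1).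
Proof.
move=> s0 hk; rewrite /= (reip_unitary _ _ (hU hk)).
exact: reip_oracle.
Qed.

(* AM-GM with ratio [3/4 : 4/3] on the states with outcome [c] and the inverse
   ratio elsewhere gives overlap at most [(1 + 8/9) / 2]. *)
Lemma qprob_overlap (out : qbasis N d -> bool) X Y c :
  2 / 3 <= qprob Us out T X c -> 2 / 3 <= qprob Us out T Y (~~ c) ->
  reip (qstate Us X T) (qstate Us Y T) <= 17 / 18.
Proof.
have := qstate_norm X (leqnn T); have := qstate_norm Y (leqnn T).
rewrite /qprob reipE; set u := qstate Us X T; set v := qstate Us Y T.
rewrite (bigID (fun beta => out beta == c)) /=.
rewrite [X in _ -> X = 1 -> _](bigID (fun beta => out beta == c)) /=.
rewrite [X in _ -> _ -> _ -> _ -> X <= _](bigID (fun beta => out beta == c)) /=.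
have eqN beta : (out beta == ~~ c) = (out beta != c) by case: out; case: c.
rewrite [X in _ -> _ -> _ -> _ <= X -> _](eq_bigl _ _ eqN).
have amgm (s a a' b b' : R) : 0 < s ->
    a * a' + b * b' <= s / 2 * (a ^+ 2 + b ^+ 2) + s^-1 / 2 * (a' ^+ 2 + b' ^+ 2).
  move=> s0; rewrite -subr_ge0.
  have -> : s / 2 * (a ^+ 2 + b ^+ 2) + s^-1 / 2 * (a' ^+ 2 + b' ^+ 2)
     - (a * a' + b * b')
     = s / 2 * ((a - s^-1 * a') ^+ 2 + (b - s^-1 * b') ^+ 2).
    by field; rewrite gt_eqF.
  by rewrite mulr_ge0 ?addr_ge0 ?sqr_ge0 // divr_ge0 // ltW.
have bound (P : pred (qbasis N d)) s : 0 < s ->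
    \sum_(beta | P beta) (complex.Re (u beta) * complex.Re (v beta)
                        + complex.Im (u beta) * complex.Im (v beta))
    <= s / 2 * (\sum_(beta | P beta) sqn (u beta))
     + s^-1 / 2 * (\sum_(beta | P beta) sqn (v beta)).
  move=> s0; rewrite !mulr_sumr -big_split; apply: ler_sum => beta _.
  exact: amgm.
have := bound (fun beta => out beta == c) (3 / 4) ltac:(lra).
have := bound (fun beta => out beta != c) (4 / 3) ltac:(lra).
rewrite !invf_div.
move: (\sum_(_ | _ == c) (_ + _)) (\sum_(_ | _ != c) (_ + _)) => S1 S2.
rewrite /sqn.
move: (\sum_(_ | _ == c) _) (\sum_(_ | _ != c) _) => p p'.
move: (\sum_(_ | _ == c) _) (\sum_(_ | _ != c) _) => q q'.
lra.
Qed.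

End Inner.

(** * Counting the pairs that differ at a coordinate *)

Section SwapSymmetry.
Variable N : nat.
Implicit Types (X Y : input N) (i j : 'I_N).

Lemma hweightE X : hweight X = (\sum_i X i)%N.
Proof. by rewrite /hweight -sum1_card big_mkcond. Qed.

Definition swap i j X : input N := [ffun k => X (tperm i j k)].

Lemma swapK i j : involutive (swap i j).
Proof. by move=> X; apply/ffunP => k; rewrite !ffunE tpermK. Qed.

Lemma hweight_swap i j X : hweight (swap i j X) = hweight X.
Proof.
rewrite !hweightE [RHS](reindex_inj (@perm_inj _ (tperm i j))).
by apply: eq_bigr => k _; rewrite ffunE.
Qed.

Lemma swap_id i j X : X i = X j -> swap i j X = X.
Proof. by move=> eqX; apply/ffunP => k; rewrite ffunE; case: tpermP => [->|->|]. Qed.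

(* All coordinates [j] with [X j = v] are flipped by equally many neighbours of
   [X], because exchanging two of them permutes the neighbours. *)
Lemma flip_count (E : pred (input N)) X (v : bool) (m delta : nat) :
  (forall i j Y, X i = X j -> E Y -> E (swap i j Y)) ->
  (forall Y i, E Y -> X i != Y i -> X i = v) ->
  (forall Y, E Y -> (\sum_i (X i != Y i))%N = delta) ->
  (\sum_i (X i == v))%N = m ->
  forall i, (m * \sum_(Y | E Y) (X i != Y i) <= delta * #|E|)%N.
Proof.
move=> swapE flipv diffE cardv i.
have [Xi|Xi] := eqVneq (X i) v; last first.
  rewrite (big1 _ E) ?muln0 // => Y EY; case: eqP => //= /eqP/(flipv _ _ EY).
  by move/eqP; rewrite (negbTE Xi).
(* Double counting of the pairs ([Y], [j]) with [Y] differing from [X] at [j]; the indices with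
   [X j = v] alone already give the bound. *)
rewrite [leqRHS]mulnC -sum_nat_const -(eq_bigr _ diffE) exchange_big /= -cardv.
rewrite big_distrl /=; apply: leq_sum => j _.
have [Xj|] := eqVneq (X j) v; last by rewrite mul0n.
have eqX : X i = X j by rewrite Xi Xj.
rewrite mul1n (reindex_inj (can_inj (swapK i j))) /= leq_eqVlt; apply/orP; left.
apply/eqP; apply: eq_big => [Y|Y _].
  apply/idP/idP; last exact: swapE.
  by move/(swapE i j _ eqX); rewrite swapK.
by rewrite ffunE tpermL eqX.
Qed.

(** Inclusion makes every differing coordinate a zero of [X] and a one of [Y], the single direction
    that [flip_count] requires. *)
Definition between (a b : nat) X Y : bool :=
  [&& hweight X == a, hweight Y == b & [forall i, X i ==> Y i]].

Lemma between_diff a b X Y : between a b X Y ->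
  (\sum_i (X i != Y i))%N = (b - a)%N.
Proof.
case/and3P => /eqP <- /eqP <- /forallP XY; rewrite !hweightE -sumnB.
  by apply: eq_bigr => i _; have := XY i; case: (X i); case: (Y i).
by move=> i _; have := XY i; case: (X i); case: (Y i).
Qed.

Lemma between_swap a b i j X Y :
  between a b X Y -> between a b (swap i j X) (swap i j Y).
Proof.
rewrite /between !hweight_swap => /and3P[-> -> /forallP XY] /=.
by apply/forallP => k; rewrite !ffunE.
Qed.

Lemma between_flip_up a b X i :
  ((N - a) * \sum_(Y | between a b X Y) (X i != Y i)
   <= (b - a) * #|[pred Y | between a b X Y]|)%N.
Proof.
have [/eqP wX|nX] := boolP (hweight X == a); last first.
  by rewrite big_pred0 ?muln0 // => Y; rewrite /between (negbTE nX).
apply: (@flip_count [pred Y | between a b X Y] X false) => /=.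
- by move=> k l Y eqX /(between_swap k l); rewrite swap_id.
- by move=> Y k /and3P[_ _ /forallP/(_ k)]; case: (X k); case: (Y k).
- by move=> Y; exact: between_diff.
rewrite -wX hweightE; apply/eqP; rewrite -(eqn_add2r (\sum_i X i)) -big_split /=.
rewrite subnK; last first.
  by rewrite -[leqRHS]card_ord -sum1_card; apply: leq_sum => k _; case: (X k).
rewrite -[eqbRHS]card_ord -sum1_card; apply/eqP/eq_bigr => k _.
by case: (X k).
Qed.

Lemma between_flip_down a b Y i :
  (b * \sum_(X | between a b X Y) (X i != Y i)
   <= (b - a) * #|[pred X | between a b X Y]|)%N.
Proof.
have [/eqP wY|nY] := boolP (hweight Y == b); last first.
  by rewrite big_pred0 ?muln0 // => X; rewrite /between (negbTE nY) andbF.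
under eq_bigr => X _ do rewrite eq_sym.
apply: (@flip_count [pred X | between a b X Y] Y true) => /=.
- by move=> k l X eqY /(between_swap k l); rewrite (swap_id eqY).
- by move=> X k /and3P[_ _ /forallP/(_ k)]; case: (X k); case: (Y k).
- by move=> X /between_diff <-; apply: eq_bigr => k _; rewrite eq_sym.
by rewrite -wY hweightE; apply: eq_bigr => k _; case: (Y k).
Qed.

Lemma hweight_le X : (hweight X <= N)%N.
Proof. by rewrite /hweight -[leqRHS]card_ord max_card. Qed.

Lemma hweight_initial a : (a <= N)%N ->
  hweight ([ffun i : 'I_N => (i < a)%N] : input N) = a.
Proof.
move=> aN; rewrite hweightE -[RHS]card_ord -sum1_card.
rewrite (big_ord_widen _ (fun=> 1%N) aN) [RHS]big_mkcond.
by apply: eq_bigr => i _; rewrite ffunE; case: ltnP.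
Qed.

Lemma exists_between a b : (a <= b <= N)%N -> exists X Y, between a b X Y.
Proof.
case/andP=> ab bN; exists [ffun i : 'I_N => (i < a)%N], [ffun i : 'I_N => (i < b)%N].
rewrite /between !hweight_initial ?(leq_trans ab) // !eqxx /=.
by apply/forallP => i; rewrite !ffunE; apply/implyP => /leq_trans; apply.
Qed.

End SwapSymmetry.

(** * The adversary bound *)

Section Adversary.
Variables (R : realType) (N d : nat).
Variables (Us : nat -> qop R N d) (T : nat).
Hypothesis hU : forall k, (k <= T)%N -> unitary (Us k).
Variables (E : rel (input N)) (m1 m2 delta : nat).
Hypotheses (m1_gt0 : (0 < m1)%N) (m2_gt0 : (0 < m2)%N).
Hypothesis flip1 : forall X i,
  (m1 * \sum_(Y | E X Y) (X i != Y i) <= delta * #|[pred Y | E X Y]|)%N.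
Hypothesis flip2 : forall Y i,
  (m2 * \sum_(X | E X Y) (X i != Y i) <= delta * #|[pred X | E X Y]|)%N.

(** A basis state queries at most one coordinate, so after exchanging the sums its mass is counted
    at most [c] times; the masses add up to 1. *)
Lemma distinguishes_sum (I : finType) (P : pred I) (x y : I -> input N)
    (p : qbasis N d -> R) (c : R) :
  0 <= c -> (forall beta, 0 <= p beta) -> \sum_beta p beta = 1 ->
  (forall i, \sum_(j | P j) (x j i != y j i)%:R <= c) ->
  \sum_(j | P j) \sum_(beta | distinguishes (x j) (y j) beta) p beta <= c.
Proof.
move=> c0 p0 p1 hc; rewrite -[leRHS]mulr1 -p1 mulr_sumr.
under eq_bigr => j _ do rewrite big_mkcond.
rewrite exchange_big; apply: ler_sum => -[o w] _; rewrite /distinguishes /=.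
case: o => [i|]; last by rewrite big1 // mulr_ge0.
apply: le_trans (ler_wpM2r (p0 _) (hc i)).
by rewrite mulr_suml; apply: ler_sum => j _; case: ifP; rewrite ?mul1r ?mul0r.
Qed.

Let pairs : R := \sum_X \sum_(Y | E X Y) 1.
(** The potential of the adversary method: it starts at [pairs], and correctness forces it down to
    [17 / 18 * pairs]. *)
Let W k : R :=
  \sum_X \sum_(Y | E X Y) reip (qstate Us X k) (qstate Us Y k).

Lemma flip_ratio (I : finType) (P : pred I) (m n : nat) (b : I -> bool) :
  (0 < m)%N -> (m * \sum_(j | P j) b j <= n * #|P|)%N ->
  \sum_(j | P j) (b j)%:R <= n%:R / m%:R * \sum_(j | P j) 1 :> R.
Proof.
move=> m0; rewrite -(ler_nat R) !natrM natr_sum mulrAC ler_pdivlMr ?ltr0n //.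
by rewrite mulrC -sum1_card natr_sum.
Qed.

(** [qstate_step] is summed over the pairs; amplitudes of [X] are grouped by [X] and bounded through
    [flip1], those of [Y] by [Y] and bounded through [flip2]. *)
Lemma adversary_step (s : R) k : 0 < s -> (k < T)%N ->
  W k - (s * (delta%:R / m1%:R) + s^-1 * (delta%:R / m2%:R)) * pairs <= W k.+1.
Proof.
move=> s0 kT; rewrite lerBlDr.
pose A X Y := \sum_(beta | distinguishes X Y beta) sqn (qstate Us X k beta).
pose B X Y := \sum_(beta | distinguishes X Y beta) sqn (qstate Us Y k beta).
have hk := ltnW kT.
have hA : \sum_X \sum_(Y | E X Y) A X Y <= delta%:R / m1%:R * pairs.
  rewrite /pairs mulr_sumr; apply: ler_sum => X _; apply: distinguishes_sum.
  - by rewrite mulr_ge0 ?divr_ge0 ?sumr_ge0.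
  - by move=> beta; exact: sqn_ge0.
  - exact: (qstate_norm hU).
  - by move=> i; exact: flip_ratio.
have hB : \sum_X \sum_(Y | E X Y) B X Y <= delta%:R / m2%:R * pairs.
  rewrite /pairs (exchange_big_dep predT) //= [X in _ <= _ * X](exchange_big_dep predT) //=.
  rewrite mulr_sumr; apply: ler_sum => Y _; apply: distinguishes_sum.
  - by rewrite mulr_ge0 ?divr_ge0 ?sumr_ge0.
  - by move=> beta; exact: sqn_ge0.
  - exact: (qstate_norm hU).
  - by move=> i; exact: flip_ratio.
have hAB : W k <= W k.+1 + (s * (\sum_X \sum_(Y | E X Y) A X Y)
                   + s^-1 * (\sum_X \sum_(Y | E X Y) B X Y)).
  rewrite /W !mulr_sumr -!big_split; apply: ler_sum => X _ /=.
  rewrite !mulr_sumr -!big_split; apply: ler_sum => Y _ /=.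
  rewrite /A /B !mulr_sumr -big_split -lerBlDr /=; exact: (qstate_step hU).
apply: le_trans hAB _; rewrite lerD2l mulrDl -[X in _ <= X + _]mulrA.
by rewrite -[X in _ <= _ + X]mulrA lerD // ler_wpM2l ?invr_ge0 // ltW.
Qed.

Lemma adversary (s : R) : 0 < s -> (exists X Y, E X Y) ->
  (forall X Y, E X Y -> reip (qstate Us X T) (qstate Us Y T) <= 17 / 18) ->
  1 / 18 <= T%:R * (s * (delta%:R / m1%:R) + s^-1 * (delta%:R / m2%:R)).
Proof.
move=> s0 [X [Y EXY]] hT; set c := _ + _.
have step k : (k < T)%N -> W k - c * pairs <= W k.+1 by exact: adversary_step.
clearbody c.
have progress k : (k <= T)%N -> pairs - k%:R * c * pairs <= W k.
  elim: k => [_|k IHk kT].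
    rewrite !mul0r subr0 /W /pairs; apply: ler_sum => X' _; apply: ler_sum => Y' _.
    by rewrite (qstate_init hU).
  apply: le_trans (step _ kT); have := IHk (ltnW kT).
  by rewrite -(natr1 k) !mulrDl mul1r; lra.
have WT : W T <= 17 / 18 * pairs.
  rewrite /W /pairs mulr_sumr; apply: ler_sum => X' _.
  by rewrite mulr_sumr; apply: ler_sum => Y' EXY'; rewrite mulr1 hT.
have pairs0 : 0 < pairs.
  have pos X' : 0 <= \sum_(Y' | E X' Y') 1 :> R by rewrite sumr_ge0.
  rewrite /pairs (bigD1 X) //= ltr_pwDl ?sumr_ge0 //.
  by rewrite (bigD1 Y) //= ltr_pwDl ?sumr_ge0.
rewrite -(ler_pM2r pairs0); have := le_trans (progress T (leqnn T)) WT; lra.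
Qed.

Lemma adversary_bound : (0 < delta)%N -> (exists X Y, E X Y) ->
  (forall X Y, E X Y -> reip (qstate Us X T) (qstate Us Y T) <= 17 / 18) ->
  (m1 * m2 <= 1296 * T ^ 2 * delta ^ 2)%N.
Proof.
move=> delta_gt0 exE hT.
(* Without queries, [adversary] would read [1 / 18 <= 0]. *)
have T_gt0 : (0 < T)%N.
  rewrite lt0n; apply/eqP => T0.
  by have := adversary (@ltr01 R) exE hT; rewrite T0 mul0r; lra.
have d0 : 0 < delta%:R :> R by rewrite ltr0n.
have t0 : 0 < T%:R :> R by rewrite ltr0n.
have p0 : 0 < m1%:R :> R by rewrite ltr0n.
have q0 : 0 < m2%:R :> R by rewrite ltr0n.
(* This [s] makes the second term of [adversary] equal to [1 / 36]. *)
pose s : R := 36 * T%:R * delta%:R / m2%:R.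
have s0 : 0 < s by rewrite divr_gt0 ?mulr_gt0.
have := adversary s0 exE hT.
have -> : T%:R * (s * (delta%:R / m1%:R) + s^-1 * (delta%:R / m2%:R))
   = 36 * T%:R ^+ 2 * delta%:R ^+ 2 / (m1%:R * m2%:R) + 1 / 36.
  by rewrite /s; field; rewrite !gt_eqF.
(* What is left is [1 / 36 <= 36 T^2 delta^2 / (m1 m2)], whence [1296 = 36^2]. *)
rewrite -lerBlDr ler_pdivlMr ?mulr_gt0 // => h.
by rewrite -(ler_nat R) !(natrM, natrX); lra.
Qed.

End Adversary.

(** The adversary bound for [between], with [m1] the number of zeros of [X] and [m2] the number of
    ones of [Y]. Symmetry gives all inputs of these two weights the values [f X] and [f Y]. *)
Lemma opposite_weights_far (R : realType) (N : nat) (f : pfun N) (T : nat)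
    (X Y : input N) (c : bool) :
  symmetric_pfun f -> quantum_computes R f T ->
  f X = Some c -> f Y = Some (~~ c) -> (hweight X < hweight Y)%N ->
  (hweight Y * (N - hweight X)
   <= 1296 * T ^ 2 * (hweight Y - hweight X) ^ 2)%N.
Proof.
move=> symf [d [Us [out [hU hout]]]] fX fY ltXY.
have YN := hweight_le Y.
rewrite mulnC; apply: (@adversary_bound R N d Us T hU
  (between (hweight X) (hweight Y))); rewrite ?subn_gt0 //.
- exact: leq_trans YN.
- exact: leq_ltn_trans ltXY.
- by move=> *; exact: between_flip_up.
- by move=> *; exact: between_flip_down.
- by apply: exists_between; rewrite ltnW.
move=> X' Y' /and3P[/eqP wX /eqP wY _].
apply: (qprob_overlap hU (out := out) (c := c)); apply: hout.
  by rewrite (symf _ X).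
by rewrite (symf _ Y).
Qed.

(** * Sampling with replacement *)

Section Sampling.
Variables (R : realType) (N : nat).
Implicit Types (X : input N) (w : seq 'I_N) (g : 'I_N -> R).

(** The [N^K] equally likely outcomes of [K] independent uniform draws. *)
Fixpoint words (K : nat) : seq (seq 'I_N) :=
  if K is K'.+1 then [seq i :: w | i <- enum 'I_N, w <- words K'] else [:: [::]].

Lemma sum_wordsS K (F : seq 'I_N -> R) :
  \sum_(w <- words K.+1) F w = \sum_i \sum_(w <- words K) F (i :: w).
Proof. by rewrite /= big_allpairs_dep big_enum. Qed.

Lemma size_words K w : w \in words K -> size w = K.
Proof.
elim: K w => [|K IHK] w /=; first by rewrite inE => /eqP ->.
by case/allpairsP => -[i w'] [_ /IHK <- ->].
Qed.

Lemma card_words K : \sum_(w <- words K) 1 = N%:R ^+ K :> R.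
Proof.
elim: K => [|K IHK]; first by rewrite big_seq1 expr0.
by rewrite sum_wordsS IHK sumr_const card_ord exprS mulr_natl.
Qed.

Lemma words_moment1 K g : \sum_i g i = 0 ->
  \sum_(w <- words K) \sum_(i <- w) g i = 0.
Proof.
move=> g0; elim: K => [|K IHK]; first by rewrite big_seq1 big_nil.
rewrite sum_wordsS.
under eq_bigr => i _.
  under eq_bigr => w _ do rewrite big_cons -[g i]mulr1.
  rewrite big_split /= IHK addr0 -mulr_sumr; over.
by rewrite -mulr_suml g0 mul0r.
Qed.

(** Variances of independent draws add up: the cross terms vanish by [words_moment1]. The factor [N]
    on the left avoids the exponent [K - 1]. *)
Lemma words_moment2 K g : \sum_i g i = 0 ->
  N%:R * (\sum_(w <- words K) (\sum_(i <- w) g i) ^+ 2)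
  = K%:R * N%:R ^+ K * \sum_i g i ^+ 2.
Proof.
move=> g0; elim: K => [|K IHK]; first by rewrite big_seq1 big_nil expr2; ring.
rewrite sum_wordsS.
under eq_bigr => i _.
  under eq_bigr => w _ do
    rewrite big_cons sqrrD -[X in X + _ + _]mulr1 -mulr_natl mulrA.
  rewrite !big_split /= -!mulr_sumr card_words words_moment1 // mulr0 addr0; over.
rewrite big_split /= -mulr_suml sumr_const card_ord -[X in _ * (_ + X)]mulr_natl IHK exprS -natr1.
ring.
Qed.

(** A non-adaptive tree: [c] accumulates the ones seen, and a repeated coordinate is queried and
    counted again. *)
Fixpoint query_word (D : nat -> bool) w (c : nat) : dtree N :=
  if w is i :: w' then DNode i (query_word D w' c) (query_word D w' c.+1)
  else DLeaf N (D c).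

Lemma eval_query_word D w c X :
  dt_eval X (query_word D w c) = D (c + count X w)%N.
Proof.
elim: w c => [|i w IHw] c /=; first by rewrite addn0.
by rewrite !IHw; case: (X i); rewrite ?addnS.
Qed.

Lemma queries_query_word D w c X : dt_queries X (query_word D w c) = size w.
Proof. by elim: w c => [|i w IHw] c //=; rewrite !IHw; case: (X i). Qed.

Definition sampling_alg (K : nat) (D : nat -> bool) : ralg R N :=
  [seq (N%:R ^- K, query_word D w 0) | w <- words K].

Hypothesis N_gt0 : (0 < N)%N.

Let N0 : N%:R != 0 :> R.
Proof. by rewrite pnatr_eq0 -lt0n. Qed.

Lemma sampling_valid K D : ralg_valid (sampling_alg K D).
Proof.
split; first by rewrite all_map; apply/allP => w _; rewrite /= invr_ge0 exprn_ge0.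
rewrite /sampling_alg big_map -[RHS](mulVf (expf_neq0 K N0)) -card_words mulr_sumr.
by apply: eq_bigr => w _; rewrite mulr1.
Qed.

Lemma sampling_queries K D X :
  ralg_exp_queries (sampling_alg K D) X = K%:R.
Proof.
rewrite /ralg_exp_queries /sampling_alg big_map big_seq.
under eq_bigr => w hw do rewrite queries_query_word (size_words hw) -[X in X * _]mulr1.
rewrite -big_seq -mulr_suml -mulr_sumr card_words mulVf ?mul1r //.
exact: expf_neq0.
Qed.

Lemma sampling_prob K D X b :
  ralg_prob (sampling_alg K D) X b
  = 1 - N%:R ^- K * \sum_(w <- words K | D (count X w) != b) 1.
Proof.
have [_ total] := sampling_valid K D.
have -> : N%:R ^- K * \sum_(w <- words K | D (count X w) != b) 1
    = \sum_(p <- sampling_alg K D | dt_eval X p.2 != b) p.1.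
  rewrite big_map mulr_sumr; apply: eq_big => w; last by rewrite mulr1.
  by rewrite eval_query_word.
by rewrite -[X in X - _]total (bigID (fun p => dt_eval X p.2 == b)) /= addrK.
Qed.

Lemma sampling_variance K X :
  \sum_(w <- words K) (N%:R * (count X w)%:R - K%:R * (hweight X)%:R) ^+ 2
  = K%:R * N%:R ^+ K * ((hweight X)%:R * (N%:R - (hweight X)%:R)) :> R.
Proof.
set m := (hweight X)%:R; pose g i : R := N%:R * (X i)%:R - m.
have sumX : \sum_i (X i)%:R = m by rewrite /m hweightE natr_sum.
have g0 : \sum_i g i = 0.
  by rewrite sumrB -mulr_sumr sumX sumr_const card_ord -[X in _ - X]mulr_natl subrr.
have g2 : \sum_i g i ^+ 2 = N%:R * (m * (N%:R - m)).
  (* Each [X i] is 0 or 1, hence equal to its square, and the summand becomes affine in it. *)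
  have -> : \sum_i g i ^+ 2
      = \sum_i ((N%:R ^+ 2 - 2 * N%:R * m) * (X i)%:R + m ^+ 2).
    by apply: eq_bigr => i _; rewrite /g; case: (X i) => /=; ring.
  rewrite big_split /= -mulr_sumr sumX sumr_const card_ord -[X in _ + X = _]mulr_natl; ring.
apply: (mulfI N0).
transitivity (K%:R * N%:R ^+ K * \sum_i g i ^+ 2); last by rewrite g2; ring.
rewrite -words_moment2 //; congr (_ * _).
rewrite big_seq [RHS]big_seq; apply: eq_bigr => w /size_words <-; congr (_ ^+ 2).
elim: w => [|i w IHw] /=; first by rewrite big_nil; ring.
by rewrite big_cons -IHw /g natrD -(natr1 (size w)); ring.
Qed.

(* Output the value at the weight nearest to the empirical estimate; an error on
   [X] forces the estimate to be off by half the distance to the opposite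
   weights, and Chebyshev applies. The [+ 1] covers the weights [0] and [N]. *)
Lemma sampling_computes (f : pfun N) (L K : nat) X0 :
  (0 < K)%N -> (12 * L <= K)%N -> f X0 != None ->
  (forall X Y c, f X = Some c -> f Y = Some (~~ c) ->
    (hweight X)%:R * (N%:R - (hweight X)%:R) + 1
      <= L%:R * ((hweight X)%:R - (hweight Y)%:R) ^+ 2 :> R) ->
  exists D, ralg_computes f (sampling_alg K D).
Proof.
move=> K_gt0 LK domX0 far.
pose dist (c : nat) X : R := `|N%:R * c%:R - K%:R * (hweight X)%:R|.
(* [X0] is the domain point from which [Order.arg_min] starts, so the minimizer lies in the
   domain. *)
pose D c := f (Order.arg_min X0 (fun X => f X != None) (dist c)) == Some true.
exists D; split=> [|X b fX]; first exact: sampling_valid.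
rewrite sampling_prob; set err := \sum_(w <- _ | _) _.
have K0 : 0 < K%:R :> R by rewrite ltr0n.
have N1 : 0 < N%:R ^+ K :> R by rewrite exprn_gt0 // ltr0n.
pose v : R := (hweight X)%:R * (N%:R - (hweight X)%:R).
have v0 : 0 <= v by rewrite mulr_ge0 // subr_ge0 ler_nat hweight_le.
pose G w : R := N%:R * (count X w)%:R - K%:R * (hweight X)%:R.
have errG w : D (count X w) != b -> K%:R ^+ 2 * (v + 1) <= 4 * L%:R * G w ^+ 2.
  rewrite /D; case: arg_minP => // Y domY minY errY.
  have fY : f Y = Some (~~ b).
    by move: domY errY; case: (f Y) => [[]|] //; case: (b).
  have := far X Y b fX fY; rewrite -/v => farXY.
  have closeY : dist (count X w) Y <= `|G w| by apply: minY; rewrite fX.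
  (* Triangle inequality through the estimate, which is at least as close to [Y] as to [X]. *)
  have gap : K%:R * `|(hweight X)%:R - (hweight Y)%:R| <= 2 * `|G w|.
    rewrite -[K%:R]ger0_norm // -normrM.
    have -> : K%:R * ((hweight X)%:R - (hweight Y)%:R)
       = (N%:R * (count X w)%:R - K%:R * (hweight Y)%:R) - G w.
      by rewrite /G; ring.
    by apply: le_trans (ler_normB _ _) _; move: closeY; rewrite /dist; lra.
  have gap2 : K%:R ^+ 2 * ((hweight X)%:R - (hweight Y)%:R) ^+ 2 <= 4 * G w ^+ 2.
    have := gap; rewrite -(ler_pXn2r (n := 2)) ?nnegrE ?mulr_ge0 //.
    by rewrite !exprMn !real_normK ?num_real //; lra.
  have := ler_wpM2l (sqr_ge0 K%:R) farXY.
  have := ler_wpM2l (ler0n R L) gap2; lra.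
have errK : K%:R ^+ 2 * (v + 1) * err <= 4 * L%:R * (K%:R * N%:R ^+ K * v).
  rewrite -sampling_variance -/v /err !mulr_sumr big_mkcond /=.
  apply: ler_sum => w _; case: ifP => [/errG|_]; first by rewrite mulr1.
  by rewrite mulr_ge0 ?sqr_ge0 // mulr_ge0.
(* [12 = 4 * 3]: the 4 is the squared factor 2 of [gap], the 3 comes from the allowed error
   [1 / 3]. *)
have LK' : 12 * L%:R <= K%:R :> R by rewrite -natrM ler_nat.
suff err3 : err <= N%:R ^+ K / 3.
  have := ler_wpM2l (_ : 0 <= N%:R ^- K) err3.
  rewrite invr_ge0 ltW // => /(_ isT); rewrite mulrA mulVf ?gt_eqF //; lra.
have pos : 0 < K%:R ^+ 2 * (v + 1) by rewrite mulr_gt0 ?exprn_gt0 // ltr_wpDl.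
rewrite -(ler_pM2l pos); apply: le_trans errK _.
have h1 : 0 <= K%:R * N%:R ^+ K * v by rewrite mulr_ge0 // mulr_ge0 // ltW.
have h2 := ler_wpM2r h1 LK'.
have h3 : 0 <= K%:R ^+ 2 * N%:R ^+ K :> R by rewrite mulr_ge0 ?sqr_ge0 // ltW.
lra.
Qed.

End Sampling.

(** * Bounding [Rquery] by explicit algorithms, and the conclusion *)

Lemma Rquery_le (R : realType) (N : nat) (f : pfun N) (A : ralg R N) (c : R) :
  0 <= c -> ralg_computes f A ->
  (forall X, f X != None -> ralg_exp_queries A X <= c) -> Rquery R f <= c.
Proof.
move=> c0 hA hc; apply: (@le_trans _ _ (ralg_cost f A)); last exact: bigmax_le.
apply: ge_inf; last by exists A.
(* Costs are maxima starting from 0, so the set under [inf] is bounded below. *)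
by exists 0 => _ [B [_ ->]]; exact: bigmax_ge_id.
Qed.

Lemma Rquery_constant (R : realType) (N : nat) (f : pfun N) (c : bool) :
  (forall X, f X != Some (~~ c)) -> Rquery R f <= 0.
Proof.
move=> fc; apply: (@Rquery_le R N f [:: (1, DLeaf N c)]) => //.
  split; first by split; rewrite /= ?ler01 ?big_seq1.
  move=> X b fX; have -> : b = c.
    by move: (fc X); rewrite fX; case: b c {fX fc} => [] [].
  by rewrite /ralg_prob big_mkcond big_seq1 /= eqxx; lra.
by move=> X _; rewrite /ralg_exp_queries big_seq1 mulr0.
Qed.

(* R(f) = O(Q(f)^2): there is an absolute constant C such that for every
   partial symmetric f and every T-query bounded-error quantum algorithm
   for f (in particular T = Q(f)), R(f) <= C * T^2. *)
Theorem theorem27 :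
  exists C : nat,
    forall (R : realType) (N : nat) (f : pfun N) (T : nat),
      symmetric_pfun f ->
      quantum_computes R f T ->
      Rquery R f <= (C * T ^ 2)%:R.
Proof.
(* [15552 = 12 * 1296], with 12 from [sampling_computes] and 1296 from [opposite_weights_far]. *)
exists 15552%N => R N f T symf qf.
have [fF|] := pselect (forall X, f X != Some true).
  by apply: le_trans (ler0n _ _); exact: (@Rquery_constant _ _ _ false).
have [fT _|] := pselect (forall X, f X != Some false).
  by apply: le_trans (ler0n _ _); exact: (@Rquery_constant _ _ _ true).
move=> /existsNP[X0 /negP/negPn/eqP fX0] /existsNP[X1 /negP/negPn/eqP fX1].
(* For weights [a < b], the integer [b * (N - a)] exceeds both [a * (N - a)] and [b * (N - b)],
   which pays for the [+ 1]; being positive, it also forces [0 < T]. *)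
have sep X Y c : f X = Some c -> f Y = Some (~~ c) ->
    (0 < T)%N /\ (hweight X)%:R * (N%:R - (hweight X)%:R) + 1
      <= (1296 * T ^ 2)%:R * ((hweight X)%:R - (hweight Y)%:R) ^+ 2 :> R.
  move=> fX fY; have XN := hweight_le X; have YN := hweight_le Y.
  have [lt|gt|eq] := ltngtP (hweight X) (hweight Y).
  - have := opposite_weights_far symf qf fX fY lt.
    move: (hweight X) (hweight Y) XN YN lt => a b aN bN ab h; split; first nia.
    rewrite -(natrB _ aN) -(sqrrN (_ - _)) opprB -(natrB _ (ltnW ab)).
    by rewrite -!natrX -!natrM natr1 ler_nat; nia.
  - have fX' : f X = Some (~~ ~~ c) by rewrite negbK.
    have := opposite_weights_far symf qf fY fX' gt.
    move: (hweight X) (hweight Y) XN YN gt => a b aN bN ab h; split; first nia.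
    rewrite -(natrB _ aN) -(natrB _ (ltnW ab)).
    by rewrite -!natrX -!natrM natr1 ler_nat; nia.
  by move: fY; rewrite -(symf X) // fX => -[]; case: (c).
have [T0 _] := sep X0 X1 false fX0 fX1.
(* For [N = 0] only the weight 0 exists, and symmetry would identify [f X0] with [f X1]. *)
have N0 : (0 < N)%N.
  case: (posnP N) => // N0; move: fX1; rewrite (symf X1 X0) ?fX0 //.
  have := hweight_le X0; have := hweight_le X1; lia.
have [||||D hD] := @sampling_computes R N N0 f (1296 * T ^ 2) (15552 * T ^ 2) X0.
- by rewrite muln_gt0 expn_gt0 T0.
- by rewrite mulnA.
- by rewrite fX0.
- by move=> X Y c fX fY; have [] := sep X Y c fX fY.
apply: Rquery_le hD _ => // X _; by rewrite sampling_queries.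
Qed.
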